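(* Consider $\mathbb{R}^{2n+1}$ with coordinates $(q_1,\dots,q_n,p_1,\dots,p_n,z)$ and contact form $\eta=\mathrm{d}z-\sum_jp_j\mathrm{d}q_j$. Let $\mathcal{L}$ be a Legendre submanifold of $\mathbb{R}^{2n+1}$ parametrized (locally) by $(q_i,p_a)$, $i\in I$, $a\notin I$, for a subset $I\subset\{1,\dots,n\}$ and a smooth generating function $S(q_i,p_a)$, via $$q_a=-\frac{\partial S}{\partial p_a},\quad p_i=\frac{\partial S}{\partial q_i},\quad z=S-\sum_{a\notin I}p_a\frac{\partial S}{\partial p_a}.$$ Let $$Y_\lambda=\sum_{j\in I}f_j(q_i,p_a,\lambda)\frac{\partial}{\partial q_j}+\sum_{b\notin I}f_b(q_i,p_a,\lambda)\frac{\partial}{\partial p_b}$$ be an arbitrary family of vector fields on $\mathcal{L}$ (expressed in the coordinates $(q_i,p_a)$ of $\mathcal{L}$), where the $f_r$ are smooth functions depending on parameter(s) $\lambda\in\mathbb{R}^\ell$. Then there exists a family of contact vector fields $X_\lambda$ on a neighbourhood of $\mathcal{L}$ in $\mathbb{R}^{2n+1}$ whose restriction to $\mathcal{L}$ is equal to $Y_\lambda$: that is, for $x\in\mathcal{L}$, $X_\lambda(x)=Y_\lambda(x)$.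
   Context: All objects are smooth. A Legendre submanifold of a $(2n+1)$-dimensional contact manifold is an $n$-dimensional submanifold everywhere tangent to the contact hyperplanes $\xi=\ker\eta$. A contact vector field is a vector field whose flow preserves $\xi$, equivalently $L_X\eta=f\eta$ for some function $f$. Every Legendre submanifold of $\mathbb{R}^{2n+1}$ is locally of the form given for some $I$ and $S$, and conversely any such $I,S$ define a Legendre submanifold. *)

(* Defs.v *)
From HB Require Import structures.
From mathcomp Require Import all_boot all_order all_algebra.
From mathcomp Require Import all_classical all_reals all_analysis.

Set Implicit Arguments.
Unset Strict Implicit.
Unset Printing Implicit Defensive.

Import Order.TTheory GRing.Theory Num.Theory.
Import numFieldNormedType.Exports.

Local Open Scope classical_set_scope.
Local Open Scope ring_scope.

(* C^k and C^oo maps on an open subset [U] of a finite-dimensional space [V].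
   The maps are total functions, but for open [U] only their values on [U]
   matter. *)
Fixpoint Ck_on {R : realType} {V W : normedModType R} (k : nat)
    (U : set V) (f : V -> W) : Prop :=
  match k with
  | 0%N => forall x, U x -> {for x, continuous f}
  | k'.+1 => (forall x, U x -> differentiable f x) /\
             (forall v, Ck_on k' U (fun x => 'D_v f x))
  end.

Definition smooth_on {R : realType} {V W : normedModType R}
  (U : set V) (f : V -> W) : Prop := forall k, Ck_on k U f.

(* A 1-form on (an open subset of) [V] is written [w x v], linear in [v].
   Extending [v] to a constant vector field, (L_X w)(v) = X(w(v)) - w([X, v])
   and [X, v] = - D_v X; in coordinates this is
   (L_X w)_k = \sum_j (X_j d_j w_k + w_j d_k X_j). *)
Definition Lie_derivative {R : realType} {V : normedModType R}
    (X : V -> V) (w : V -> V -> R) (x v : V) : R :=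
  'D_(X x) (fun y => w y v) x + w x ('D_v X x).

Section contact.
Variables (R : realType) (n : nat).

(* Points of R^(2n+1), and tangent vectors, are rows (q, p, z). *)
Definition qcoord (x : 'rV[R]_(n + n + 1)) (j : 'I_n) : R :=
  x ord0 (lshift 1 (lshift n j)).
Definition pcoord (x : 'rV[R]_(n + n + 1)) (j : 'I_n) : R :=
  x ord0 (lshift 1 (rshift n j)).
Definition zcoord (x : 'rV[R]_(n + n + 1)) : R :=
  x ord0 (rshift (n + n) ord0).

Definition mkpoint (q p : 'rV[R]_n) (z : R) : 'rV[R]_(n + n + 1) :=
  row_mx (row_mx q p) (const_mx z).

(* The contact form dz - \sum_j p_j dq_j. *)
Definition eta (x v : 'rV[R]_(n + n + 1)) : R :=
  zcoord v - \sum_j pcoord x j * qcoord v j.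

Definition contact_field_on (W : set 'rV[R]_(n + n + 1))
    (X : 'rV[R]_(n + n + 1) -> 'rV[R]_(n + n + 1)) : Prop :=
  smooth_on W X /\
  exists2 g : 'rV[R]_(n + n + 1) -> R, smooth_on W g &
    forall x, W x -> forall v, Lie_derivative X eta x v = g x * eta x v.

Definition partial {W : normedModType R} (j : 'I_n) (f : 'rV[R]_n -> W)
  (u : 'rV[R]_n) : W := 'D_(delta_mx ord0 j) f u.

(* The coordinates (q_i, p_a), i \in I, a \notin I, are collected in one row
   [u], with u_j = q_j if j \in I and u_j = p_j otherwise. *)
Definition legendre_param (I : {set 'I_n}) (S : 'rV[R]_n -> R)
    (u : 'rV[R]_n) : 'rV[R]_(n + n + 1) :=
  mkpoint (\row_j (if j \in I then u ord0 j else - partial j S u))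
          (\row_j (if j \in I then partial j S u else u ord0 j))
          (S u - \sum_(a | a \notin I) u ord0 a * partial a S u).

(* The vector field \sum_r f_r d/du_r on the submanifold, as an ambient vector:
   in the coordinates u, the tangent vector d/du_r (that is, d/dq_r if r \in I
   and d/dp_r otherwise) is the r-th partial derivative of the
   parametrization. *)
Definition legendre_field (I : {set 'I_n}) (S : 'rV[R]_n -> R)
    (f : 'I_n -> R) (u : 'rV[R]_n) : 'rV[R]_(n + n + 1) :=
  \sum_r f r *: partial r (legendre_param I S) u.

End contact.

(* Main.v *)
(** A contact vector field is determined by its Hamiltonian [K = eta X], and
    [K |-> X_K] needs only first derivatives of [K].  Write [u] for the
    coordinates [(q_i, p_a)] of a point.  The functions [p_i - dS/dq_i]
    ([i \in I]) and [q_a + dS/dp_a] ([a \notin I]) vanish on the Legendre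
    submanifold, so
      [K = - \sum_(i \in I) f_i(u) (p_i - dS/dq_i)
           + \sum_(a \notin I) f_a(u) (q_a + dS/dp_a)]
    vanishes there too, and on the submanifold its first derivatives see [f]
    only through its values.  The [u]-components of [X_K] are then [f]; the
    conjugate components are the derivatives of [-dS/dp_a] and [dS/dq_i] along
    [f], by symmetry of the second derivatives of [S]; and the [z]-component
    is forced because both [X_K] and [Y] lie in [ker eta] on the submanifold.
    All of this holds on the full preimage of [U] under [(q, p, z) |-> u]. *)
Require Import Defs.
From HB Require Import structures.
From mathcomp Require Import all_boot all_order all_algebra.
From mathcomp Require Import all_classical all_reals all_analysis.
From mathcomp Require Import ring.
Import Order.TTheory GRing.Theory Num.Theory.
Import numFieldNormedType.Exports.
Local Open Scope classical_set_scope.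
Local Open Scope ring_scope.

Set Implicit Arguments.
Unset Strict Implicit.

(** * Locality of differentiability, and derivatives of a composite with an affine map *)

Section derive_affine.
Context {R : realType} {V V' W : normedModType R}.
Implicit Types (f g : V -> W) (L : V' -> V).

Lemma near_eq_differentiable f g x :
  {near x, f =1 g} -> differentiable f x -> differentiable g x.
Proof.
move=> fg /[dup] /diff_continuous dc /diff_locally df.
(* The first-order expansion of [f] at [x] is also one of [g], since it involves only values near
   [x]; uniqueness of the linear part then identifies ['d f x] with the differential of [g]. *)
have dg : g \o shift x = cst (g x) + 'd f x +o_ 0 id.
  apply/eqaddoE/eqaddoP => _/posnumP[e].
  have /eqaddoP := df => /(_ _ (gt0 e)) dfe.
  near=> h.
  have fgh : f (h + x) = g (h + x).
    by near: h; move: fg; rewrite [in X in X -> _](near_shift 0 x) /= subr0.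
  rewrite !fctE -fgh -(nbhs_singleton fg).
  by near: h.
have e := diff_unique dc dg.
by apply/diff_locallyP; rewrite e.
Unshelve. all: by end_near. Qed.

Lemma affine_growth_rate f L (x m : V') (d : V) :
  (forall h : R, L (h *: m + x) = h *: d + L x) ->
  (fun h : R => h^-1 *: ((f \o L) (h *: m + x) - (f \o L) x)) =
  (fun h : R => h^-1 *: (f (h *: d + L x) - f (L x))).
Proof. by move=> Lm; apply/funext => h /=; rewrite Lm. Qed.

(** Both sides are limits of literally the same difference quotient, so no chain rule enters. *)
Lemma derive_comp_affine f L (x m : V') (d : V) :
  (forall h : R, L (h *: m + x) = h *: d + L x) ->
  'D_m (f \o L) x = 'D_d f (L x).
Proof. by move=> Lm; rewrite /derive -(affine_growth_rate f Lm). Qed.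

Lemma derivable_comp_affine f L (x m : V') (d : V) :
  (forall h : R, L (h *: m + x) = h *: d + L x) ->
  derivable f (L x) d -> derivable (f \o L) x m.
Proof. by move=> Lm; rewrite /derivable -(affine_growth_rate f Lm). Qed.

End derive_affine.

(** * Closure properties of C^k maps on open sets *)

Section smooth_calculus.
Context {R : realType} {V : normedModType R}.
Implicit Types (U : set V) (k : nat).

Lemma Ck_onS {W : normedModType R} k U (f : V -> W) :
  Ck_on k.+1 U f -> Ck_on k U f.
Proof.
elim: k f => [|k IH] f; first by case=> df _ x /df /differentiable_continuous.
by case=> df Df; split => // v; apply/IH/Df.
Qed.

(** Openness turns equality on [U] into equality near each point of [U], which passes to directional
    derivatives. Differentiation rules valid only on [U] can thus be used inside inductions on
    [k]. *)
Lemma eq_Ck_on {W : normedModType R} k U (f g : V -> W) : open U ->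
  (forall x, U x -> f x = g x) -> Ck_on k U f -> Ck_on k U g.
Proof.
move=> oU; elim: k f g => [|k IH] f g fg /=.
  move=> cf x Ux; rewrite /prop_for /continuous_at -fg//.
  apply: cvg_trans (cf x Ux); apply: near_eq_cvg.
  by apply: filterS (open_nbhs_nbhs (conj oU Ux)) => y /fg.
have near_fg x : U x -> {near x, f =1 g}.
  by move=> Ux; apply: filterS (open_nbhs_nbhs (conj oU Ux)) => y /fg.
case=> df Df; split=> [x Ux|v].
  exact: near_eq_differentiable (near_fg x Ux) (df x Ux).
by apply: IH (Df v) => x /near_fg; apply: near_eq_derive.
Qed.

Lemma Ck_on_cst {W : normedModType R} k U (c : W) : Ck_on k U (fun=> c).
Proof.
elim: k c => [|k IH] c /=; first by move=> x _; exact: cvg_cst.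
split=> [x _|v]; first exact: differentiable_cst.
by under eq_fun do rewrite derive_cst.
Qed.

Lemma Ck_onD {W : normedModType R} k U (f g : V -> W) : open U ->
  Ck_on k U f -> Ck_on k U g -> Ck_on k U (fun x => f x + g x).
Proof.
move=> oU; elim: k f g => [|k IH] f g /=.
  by move=> cf cg x Ux; apply: continuousD; [exact: cf|exact: cg].
move=> [df Df] [dg Dg]; split=> [x Ux|v].
  by apply: differentiableD; [exact: df|exact: dg].
apply: eq_Ck_on (IH _ _ (Df v) (Dg v)) => // x Ux.
by rewrite deriveD//; apply: diff_derivable; [exact: df|exact: dg].
Qed.

(** The Leibniz rule keeps an undifferentiated factor in each term, so the induction also uses both
    factors at the lower order, through [Ck_onS]. *)
Lemma Ck_onM k U (f g : V -> R) : open U ->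
  Ck_on k U f -> Ck_on k U g -> Ck_on k U (fun x => f x * g x).
Proof.
move=> oU; elim: k f g => [|k IH] f g.
  by move=> cf cg x Ux; apply: continuousM; [exact: cf|exact: cg].
move=> /[dup] /Ck_onS fk [df Df] /[dup] /Ck_onS gk [dg Dg]; split=> [x Ux|v].
  by apply: differentiableM; [exact: df|exact: dg].
apply: eq_Ck_on (Ck_onD oU (IH _ _ fk (Dg v)) (IH _ _ gk (Df v))) => // x Ux.
by rewrite deriveM//; apply: diff_derivable; [exact: df|exact: dg].
Qed.

Lemma derive_scalel {W : normedModType R} (f : V -> R) (w : W) x v :
  differentiable f x -> 'D_v (fun y => f y *: w) x = 'D_v f x *: w.
Proof.
move=> df; rewrite !deriveE ?diffZl//; exact: differentiableZl.
Qed.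

Lemma Ck_on_scalel {W : normedModType R} k U (f : V -> R) (w : W) : open U ->
  Ck_on k U f -> Ck_on k U (fun x => f x *: w).
Proof.
move=> oU; elim: k f => [|k IH] f /=.
  move=> cf x Ux.
  by apply: continuousZl; exact: cf.
move=> [df Df]; split=> [x Ux|v]; first by apply: differentiableZl; exact: df.
by apply: eq_Ck_on (IH _ (Df v)) => // x Ux; rewrite derive_scalel//; exact: df.
Qed.

(** [M] is the linear part of [L]. The derivative of [f \o L] along [m] is that of [f] along the
    constant vector [M m], again composed with [L], so the induction closes on itself. *)
Lemma Ck_on_comp_affine {V' W : normedModType R} k (U : set V) (U' : set V')
    (f : V -> W) (L : V' -> V) (M : V' -> V) :
  (forall x, differentiable L x) ->
  (forall (h : R) m x, L (h *: m + x) = h *: M m + L x) ->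
  U' `<=` L @^-1` U -> Ck_on k U f -> Ck_on k U' (f \o L).
Proof.
move=> dL LM U'U; elim: k f => [|k IH] f /=.
  move=> cf x /U'U Ux; apply: continuous_comp; last exact: cf.
  exact: differentiable_continuous.
move=> [df Df]; split=> [x /U'U Ux|m].
  by apply: differentiable_comp; [exact: dL|exact: df].
have -> : (fun x => 'D_m (f \o L) x) = (fun x => 'D_(M m) f x) \o L.
  by apply/funext => x; apply: derive_comp_affine => h; exact: LM.
exact/IH/Df.
Qed.

End smooth_calculus.

(** * Finite sums, linear maps and coordinates *)

Section smooth_sums.
Context {R : realType} {V : normedModType R}.
Implicit Types (U : set V) (k : nat).

Lemma Ck_on_sum {W : normedModType R} (J : finType) k U (f : J -> V -> W) :
  open U -> (forall j, Ck_on k U (f j)) -> Ck_on k U (fun x => \sum_j f j x).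
Proof.
move=> oU fk; elim: (index_enum J) => [|j s IH].
  by under eq_fun do rewrite big_nil; exact: Ck_on_cst.
by under eq_fun do rewrite big_cons; exact: Ck_onD.
Qed.

Lemma Ck_onN k U (f : V -> R) : open U ->
  Ck_on k U f -> Ck_on k U (fun x => - f x).
Proof.
move=> oU fk; under eq_fun do rewrite -mulN1r.
by apply: Ck_onM => //; exact: Ck_on_cst.
Qed.

Lemma derive_fsum {W : normedModType R} m (f : 'I_m -> V -> W) x v :
  (forall j, derivable (f j) x v) ->
  'D_v (fun y => \sum_j f j y) x = \sum_j 'D_v (f j) x.
Proof. by move=> df; rewrite -derive_sum// fct_sumE. Qed.

Lemma derive_linear {W : normedModType R} (f : V -> W) x v :
  (forall (h : R) m y, f (h *: m + y) = h *: f m + f y) -> 'D_v f x = f v.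
Proof.
(* A linear map is the identity composed with itself, so the affine rule applies with direction
   [f v]. *)
move=> lf; have := @derive_comp_affine _ W V W id f x v (f v).
by rewrite derive_id; apply => h; exact: lf.
Qed.

Lemma Ck_on_linear {W : normedModType R} k U (f : V -> W) :
  (forall x, differentiable f x) ->
  (forall (h : R) m y, f (h *: m + y) = h *: f m + f y) -> Ck_on k U f.
Proof.
move=> df lf; case: k => [|k].
  by move=> x _; exact: differentiable_continuous.
split=> // v; under eq_fun do rewrite derive_linear//.
exact: Ck_on_cst.
Qed.

Lemma derive_coord m (F : V -> 'rV[R]_m) x v (k : 'I_m) : derivable F x v ->
  ('D_v F x) ord0 k = 'D_v (fun y => F y ord0 k) x.
Proof. by move=> dF; rewrite derive_mx// mxE. Qed.

Lemma differentiable_row m (f : 'I_m -> V -> R) x :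
  (forall j, differentiable (f j) x) ->
  differentiable (fun y => \row_j f j y) x.
Proof.
move=> df.
have -> : (fun y => \row_j f j y) =
    \sum_(j < m) (fun y => f j y *: delta_mx ord0 j : 'rV[R]_m).
  apply/funext => y; rewrite fct_sumE [LHS]row_sum_delta.
  by apply: eq_bigr => j _; rewrite mxE.
by apply: differentiable_sum => j; exact: differentiableZl.
Qed.

Lemma derive_sumM m (f g : 'I_m -> V -> R) x v :
  (forall j, differentiable (f j) x) -> (forall j, differentiable (g j) x) ->
  'D_v (fun y => \sum_j f j y * g j y) x =
  \sum_j (f j x * 'D_v (g j) x + g j x * 'D_v (f j) x).
Proof.
move=> df dg.
have dfv j := diff_derivable (v := v) (df j).
have dgv j := diff_derivable (v := v) (dg j).
rewrite derive_fsum => [|j]; last exact: derivableM.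
by apply: eq_bigr => j _; rewrite deriveM.
Qed.

End smooth_sums.

(** * Projections from a product and cylinders over open sets *)

Lemma differentiable_fst {R : realType} {V V' : normedModType R} (y : V * V') :
  differentiable fst y.
Proof. by apply: linear_differentiable => z; exact: cvg_fst. Qed.

Lemma differentiable_snd {R : realType} {V V' : normedModType R} (y : V * V') :
  differentiable snd y.
Proof. by apply: linear_differentiable => z; exact: cvg_snd. Qed.

Lemma Ck_on_fst {R : realType} {V V' W : normedModType R} k (U : set V)
    (f : V -> W) : Ck_on k U f -> Ck_on k (U `*` [set: V']) (f \o fst).
Proof.
apply: (Ck_on_comp_affine (M := fst)) => [x|//|[x y] []//].
exact: differentiable_fst.
Qed.

Lemma open_setXT {R : realType} {V V' : normedModType R} (U : set V) :
  open U -> open (U `*` [set: V']).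
Proof.
have -> : U `*` [set: V'] = fst @^-1` U by apply/seteqP; split=> [x []|x].
by apply: open_comp => x _; exact: cvg_fst.
Qed.

(** * Symmetry of second derivatives *)

Section second_derivatives.
Context {R : realType} {V : normedModType R}.
Implicit Types (f : V -> R) (U : set V) (u v x : V).

Lemma is_derive_line f u w (s : R) : differentiable f (s *: u + w) ->
  is_derive s 1 (fun t : R => f (t *: u + w)) ('D_u f (s *: u + w)).
Proof.
have Lu (h : R) : (h *: (1 : R) + s) *: u + w = h *: u + (s *: u + w).
  by rewrite [h *: _]mulr1 scalerDl addrA.
move=> df; apply: DeriveDef.
  exact: (derivable_comp_affine (L := fun t : R => t *: u + w) Lu)
    (diff_derivable df).
exact: (derive_comp_affine f (L := fun t : R => t *: u + w) Lu).
Qed.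

Lemma MVT_line f u w (h : R) : 0 < h ->
  (forall s : R, 0 <= s <= h -> differentiable f (s *: u + w)) ->
  exists2 s : R, 0 <= s <= h & f (h *: u + w) - f w = 'D_u f (s *: u + w) * h.
Proof.
move=> h0 df.
have dfl s : s \in `[0, h] -> is_derive s 1 (fun t => f (t *: u + w))
    ('D_u f (s *: u + w)).
  by rewrite in_itv /= => /df /is_derive_line.
have fc : {within `[0, h], continuous (fun t => f (t *: u + w))}.
  by apply: derivable_within_continuous => s /dfl sP; exact: ex_derive.
have dfo s (sh : s \in `]0, h[) := dfl s (subset_itv_oo_cc sh).
have [s] := @MVT R _ (fun s => 'D_u f (s *: u + w)) 0 h h0 dfo fc.
rewrite scale0r add0r subr0 => /subset_itv_oo_cc; rewrite in_itv /= => sh e.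
by exists s.
Qed.

(** Two applications of the mean value theorem: along [u] to the increment of [f] in the direction
    [h *: v], then along [v] to ['D_u f]. *)
Lemma second_difference_MVT f U u v x (h : R) : 0 < h ->
  Ck_on 2 U f ->
  (forall s t : R, 0 <= s <= h -> 0 <= t <= h -> U (s *: u + (t *: v + x))) ->
  exists s t : R, [/\ 0 <= s <= h, 0 <= t <= h &
    (f (h *: u + (h *: v + x)) - f (h *: u + x)) - (f (h *: v + x) - f x) =
    'D_v (fun y => 'D_u f y) (s *: u + (t *: v + x)) * h * h].
Proof.
move=> h0 [df Df] Ust.
have h00 : 0 <= (0 : R) <= h by rewrite lexx ltW.
have hhh : 0 <= h <= h by rewrite lexx ltW.
pose g := fun y : V => f (y + h *: v) - f y.
have fd (s : R) : 0 <= s <= h -> differentiable f (s *: u + x).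
  by move=> sh; apply: df; have := Ust s 0 sh h00; rewrite scale0r add0r.
have fdv (s : R) : 0 <= s <= h ->
    differentiable (fun y => f (y + h *: v)) (s *: u + x).
  move=> sh.
  apply: (@differentiable_comp _ _ _ _ (fun y => y + h *: v) f) => //.
  by apply: df; rewrite -addrA [x + _]addrC; exact: Ust.
have [s sh|s sh gE] := @MVT_line g u x h h0.
  by apply: differentiableB; [exact: fdv|exact: fd].
have [t th|t th DE] := @MVT_line (fun y => 'D_u f y) v (s *: u + x) h h0.
  apply: (Df u).1.
  by rewrite addrCA; exact: Ust.
exists s, t; split => //.
rewrite [s *: u + (t *: v + x)]addrCA -DE.
(* The [u]-derivative of the increment [g] is an increment of ['D_u f] along [v], which the second
   mean value theorem has just evaluated. *)
have <- : 'D_u g (s *: u + x) =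
    'D_u f (h *: v + (s *: u + x)) - 'D_u f (s *: u + x).
  rewrite /g deriveB; [|exact/diff_derivable/fdv|exact/diff_derivable/fd].
  congr (_ - _).
  rewrite (@derive_comp_affine _ _ _ _ f (fun y => y + h *: v) _ _ u).
    by rewrite addrC.
  by move=> a; rewrite [RHS]addrA.
by rewrite -gE /g -!addrA [x + _]addrC.
Qed.

(** The two left-hand sides are one second difference grouped in two ways. *)
Fact mixed_difference_quotient (a b c d A B h : R) : h != 0 ->
  a - b - (c - d) = A * h * h -> a - c - (b - d) = B * h * h -> A = B.
Proof.
move=> h0 E1 E2; apply: (mulIf h0); apply: (mulIf h0).
by rewrite -E1 -E2; ring.
Qed.

(** The second difference of [f] is symmetric in [u] and [v] up to the order of
    summation, and equals either mixed derivative at a nearby point. *)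
Lemma derive_symmetric f U u v x : open U -> U x -> Ck_on 2 U f ->
  'D_u (fun y => 'D_v f y) x = 'D_v (fun y => 'D_u f y) x.
Proof.
move=> oU Ux f2.
have cvu : {for x, continuous (fun y => 'D_v (fun y => 'D_u f y) y)}.
  by have [_ /(_ u)[_ /(_ v) /(_ x Ux)]] := f2.
have cuv : {for x, continuous (fun y => 'D_u (fun y => 'D_v f y) y)}.
  by have [_ /(_ v)[_ /(_ u) /(_ x Ux)]] := f2.
apply/eqP; rewrite -subr_eq0 -normr_le0; apply/ler_addgt0Pl => e e0.
rewrite addr0.
have e20 : 0 < e / 2 by rewrite divr_gt0.
have nU : \forall y \near x, U y by exact: open_nbhs_nbhs.
have near_e : \forall y \near x, U y /\
    (`|'D_v (fun y => 'D_u f y) x - 'D_v (fun y => 'D_u f y) y| <= e / 2 /\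
     `|'D_u (fun y => 'D_v f y) x - 'D_u (fun y => 'D_v f y) y| <= e / 2).
  apply: filterI nU (filterI _ _).
    exact: cvgr_dist_le cvu _ e20.
  exact: cvgr_dist_le cuv _ e20.
have [r /= r0 rP] := (nbhs_ballP _ _).1 near_e.
have uv0 : 0 < `|u| + `|v| + 1 by rewrite ltr_wpDl// addr_ge0.
(* This makes [h * (|u| + |v|) < r], so the whole parallelogram spanned by [h *: u] and [h *: v] at
   [x] stays in the ball; the summand 1 keeps the denominator positive. *)
pose h := r / (`|u| + `|v| + 1).
have h0 : 0 < h by rewrite divr_gt0.
have inball (s t : R) : 0 <= s <= h -> 0 <= t <= h ->
    ball x r (s *: u + (t *: v + x)).
  move=> /andP[s0 sh] /andP[t0 th].
  rewrite -ball_normE /= distrC addrA addrK (le_lt_trans (ler_normD _ _))//.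
  rewrite !normrZ !ger0_norm//.
  rewrite (le_lt_trans (lerD (ler_wpM2r _ sh) (ler_wpM2r _ th)))//.
  by rewrite -mulrDr /h mulrAC ltr_pdivrMr// ltr_pM2l// ltrDl.
have [s [t [sh th E1]]] := @second_difference_MVT f U u v x h h0 f2
  (fun s t sh th => (rP _ (inball s t sh th)).1).
have inU' (s' t' : R) : 0 <= s' <= h -> 0 <= t' <= h ->
    U (s' *: v + (t' *: u + x)).
  by move=> sh' th'; rewrite addrCA; exact: (rP _ (inball _ _ th' sh')).1.
have [s' [t' [sh' th' E2]]] := @second_difference_MVT f U v u x h h0 f2 inU'.
rewrite [h *: v + (h *: u + x)]addrCA in E2.
have hn0 : h != 0 by rewrite gt_eqF.
have E : 'D_v (fun y => 'D_u f y) (s *: u + (t *: v + x)) =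
         'D_u (fun y => 'D_v f y) (s' *: v + (t' *: u + x)).
  exact: mixed_difference_quotient hn0 E1 E2.
have [_ [A _]] := rP _ (inball _ _ sh th).
have [_ [_ B]] := rP _ (inball _ _ th' sh').
rewrite (addrCA (t' *: u)) -E in B.
(* By [E] the two mixed derivatives share a value at points of the ball, and each of them at [x] is
   within [e / 2] of that value. *)
have close (a b c : R) :
    `|a - b| <= e / 2 -> `|c - b| <= e / 2 -> `|c - a| <= e.
  move=> ab cb; rewrite (splitr e) (le_trans (ler_distD b _ _))//.
  by rewrite lerD// distrC.
exact: close A B.
Qed.

End second_derivatives.

(** * Coordinates on the contact space and contact Hamiltonian vector fields *)

Section contact_hamiltonian.
Context {R : realType} {n : nat}.
Local Notation E := 'rV[R]_(n + n + 1).
Implicit Types (x v : E) (j : 'I_n).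

Lemma qcoord_mkpoint (q p : 'rV[R]_n) (z : R) j :
  qcoord (mkpoint q p z) j = q ord0 j.
Proof. by rewrite /qcoord /mkpoint !row_mxEl. Qed.

Lemma pcoord_mkpoint (q p : 'rV[R]_n) (z : R) j :
  pcoord (mkpoint q p z) j = p ord0 j.
Proof. by rewrite /pcoord /mkpoint row_mxEl row_mxEr. Qed.

Lemma zcoord_mkpoint (q p : 'rV[R]_n) (z : R) : zcoord (mkpoint q p z) = z.
Proof. by rewrite /zcoord /mkpoint row_mxEr mxE. Qed.

Definition mkpointE := (qcoord_mkpoint, pcoord_mkpoint, zcoord_mkpoint).

Lemma point_ext x y : (forall j, qcoord x j = qcoord y j) ->
  (forall j, pcoord x j = pcoord y j) -> zcoord x = zcoord y -> x = y.
Proof.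
move=> q p z; apply/rowP => k; case: (split_ordP k) => [i ->|i ->].
  by case: (split_ordP i) => j ->; [exact: q|exact: p].
by rewrite ord1.
Qed.

(** Despite the names, these are the coordinate vectors d/dq_j, d/dp_j and d/dz, not the
    differentials. *)
Definition dq j : E := mkpoint (delta_mx ord0 j) 0 0.
Definition dp j : E := mkpoint 0 (delta_mx ord0 j) 0.
Definition dz : E := mkpoint 0 0 1.

Lemma qcoord_sum (J : finType) (f : J -> E) j :
  qcoord (\sum_i f i) j = \sum_i qcoord (f i) j.
Proof. by rewrite /qcoord summxE. Qed.

Lemma pcoord_sum (J : finType) (f : J -> E) j :
  pcoord (\sum_i f i) j = \sum_i pcoord (f i) j.
Proof. by rewrite /pcoord summxE. Qed.

Lemma zcoord_sum (J : finType) (f : J -> E) :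
  zcoord (\sum_i f i) = \sum_i zcoord (f i).
Proof. by rewrite /zcoord summxE. Qed.

Lemma qcoordD x y j : qcoord (x + y) j = qcoord x j + qcoord y j.
Proof. by rewrite /qcoord mxE. Qed.

Lemma pcoordD x y j : pcoord (x + y) j = pcoord x j + pcoord y j.
Proof. by rewrite /pcoord mxE. Qed.

Lemma zcoordD x y : zcoord (x + y) = zcoord x + zcoord y.
Proof. by rewrite /zcoord mxE. Qed.

Lemma qcoordZ (a : R) x j : qcoord (a *: x) j = a * qcoord x j.
Proof. by rewrite /qcoord mxE. Qed.

Lemma pcoordZ (a : R) x j : pcoord (a *: x) j = a * pcoord x j.
Proof. by rewrite /pcoord mxE. Qed.

Lemma zcoordZ (a : R) x : zcoord (a *: x) = a * zcoord x.
Proof. by rewrite /zcoord mxE. Qed.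

Definition coordE := (qcoord_sum, pcoord_sum, zcoord_sum, qcoordD, pcoordD,
  zcoordD, qcoordZ, pcoordZ, zcoordZ).

Lemma sum_delta (c : 'I_n -> R) j :
  \sum_i c i * (delta_mx ord0 i : 'rV[R]_n) ord0 j = c j.
Proof.
rewrite (bigD1 j)//= big1 ?addr0 => [|i ij]; first by rewrite mxE !eqxx mulr1.
by rewrite mxE /= eq_sym (negbTE ij) mulr0.
Qed.

Lemma point_decomp x :
  x = \sum_j qcoord x j *: dq j + \sum_j pcoord x j *: dp j + zcoord x *: dz.
Proof.
apply: point_ext => [j|j|]; rewrite !coordE.
- under eq_bigr do rewrite qcoordZ mkpointE.
  rewrite sum_delta big1 => [|i _]; last by rewrite qcoordZ mkpointE mxE mulr0.
  by rewrite mkpointE mxE mulr0 !addr0.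
- rewrite big1 => [|i _]; last by rewrite pcoordZ mkpointE mxE mulr0.
  under eq_bigr do rewrite pcoordZ mkpointE.
  by rewrite sum_delta mkpointE mxE mulr0 addr0 add0r.
- rewrite big1 => [|i _]; last by rewrite zcoordZ mkpointE mulr0.
  rewrite big1 => [|i _]; last by rewrite zcoordZ mkpointE mulr0.
  by rewrite mkpointE mulr1 !add0r.
Qed.

Lemma derive_decomp (K : E -> R) x v : differentiable K x ->
  'D_v K x = \sum_j (qcoord v j * 'D_(dq j) K x + pcoord v j * 'D_(dp j) K x)
           + zcoord v * 'D_dz K x.
Proof.
move=> dK; rewrite big_split/= !deriveE// {1}[v]point_decomp.
rewrite !linearD !linear_sum linearZ; congr (_ + _ + _); apply: eq_bigr => j _.
  by rewrite linearZ deriveE.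
by rewrite linearZ deriveE.
Qed.

Lemma Ck_on_point {V : normedModType R} k (U : set V) (F : V -> E) : open U ->
  (forall j, Ck_on k U (fun y => qcoord (F y) j)) ->
  (forall j, Ck_on k U (fun y => pcoord (F y) j)) ->
  Ck_on k U (fun y => zcoord (F y)) -> Ck_on k U F.
Proof.
move=> oU qF pF zF.
have -> : F = fun y => \sum_j qcoord (F y) j *: dq j +
    \sum_j pcoord (F y) j *: dp j + zcoord (F y) *: dz.
  by apply/funext => y; exact: point_decomp.
by apply: Ck_onD => //; first (apply: Ck_onD => //);
  [apply: Ck_on_sum => // j|apply: Ck_on_sum => // j|]; exact: Ck_on_scalel.
Qed.

Lemma Ck_on_coord m k (W : set 'rV[R]_m) i :
  Ck_on k W (fun w => w ord0 i).
Proof.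
apply: Ck_on_linear => [w|h v w]; first exact: differentiable_coord.
by rewrite !mxE.
Qed.

(** The contact vector field with Hamiltonian [K]: the [z]-component is chosen so that [eta] of the
    field equals [K]. *)
Definition hamiltonian_field (K : E -> R) x : E :=
  mkpoint (\row_j - 'D_(dp j) K x)
          (\row_j ('D_(dq j) K x + pcoord x j * 'D_dz K x))
          (K x - \sum_j pcoord x j * 'D_(dp j) K x).

Lemma contact_hamiltonian_field (W : set E) (K : E -> R) : open W ->
  smooth_on W K -> contact_field_on W (hamiltonian_field K).
Proof.
move=> oW sK.
have DK v : smooth_on W (fun x => 'D_v K x) by move=> k; exact: (sK k.+1).2.
have sX : smooth_on W (hamiltonian_field K).
  move=> k; apply: Ck_on_point => // [j|j|].
  - under eq_fun do rewrite mkpointE mxE.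
    by apply: Ck_onN => //; exact: DK.
  - under eq_fun do rewrite mkpointE mxE.
    apply: Ck_onD; [exact: oW|exact: DK|].
    by apply: Ck_onM; [exact: oW|exact: Ck_on_coord|exact: DK].
  - under eq_fun do rewrite mkpointE.
    apply: Ck_onD; [exact: oW|exact: sK|].
    apply: Ck_onN => //; apply: Ck_on_sum => // j.
    by apply: Ck_onM; [exact: oW|exact: Ck_on_coord|exact: DK].
(* The conformal factor is forced: on d/dz the form [eta] is 1 and the Lie derivative is the
   [z]-derivative of [K]. *)
split=> //; exists (fun x => 'D_dz K x); first exact: DK.
move=> x Wx v.
have dK : differentiable K x by apply: (sK 1).1.
have dDK w : differentiable (fun y => 'D_w K y) x by apply: (DK w 1).1.
have dX : derivable (hamiltonian_field K) x v.
  by apply: diff_derivable; apply: (sX 1).1.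
have dpc j : differentiable (fun y : E => pcoord y j) x.
  exact: differentiable_coord.
have dzX : zcoord ('D_v (hamiltonian_field K) x) =
    'D_v K x - \sum_j (pcoord x j * 'D_v (fun y => 'D_(dp j) K y) x
                       + 'D_(dp j) K x * pcoord v j).
  rewrite /zcoord derive_coord//.
  under eq_fun do rewrite -/(zcoord _) mkpointE.
  have dS : differentiable (fun y => \sum_j pcoord y j * 'D_(dp j) K y) x.
    rewrite -fct_sumE; apply: differentiable_sum => j.
    exact: differentiableM.
  rewrite deriveB; [|exact: diff_derivable|exact: diff_derivable].
  congr (_ - _); rewrite derive_sumM//; apply: eq_bigr => j _.
  rewrite (@derive_linear _ _ _ (fun y => pcoord y j))// => h m y.
  by rewrite !coordE.
have dqX j : qcoord ('D_v (hamiltonian_field K) x) j =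
    - 'D_v (fun y => 'D_(dp j) K y) x.
  rewrite /qcoord derive_coord//.
  under eq_fun do rewrite -/(qcoord _ _) mkpointE mxE.
  by rewrite deriveN//; exact: diff_derivable.
have deta : 'D_(hamiltonian_field K x) (fun y : E => Defs.eta y v) x =
    - \sum_j qcoord v j * ('D_(dq j) K x + pcoord x j * 'D_dz K x).
  rewrite (_ : (fun y : E => Defs.eta y v) =
      fun y : E => cst (zcoord v) y - \sum_j qcoord v j * pcoord y j);
    last first.
    apply/funext => y; rewrite /Defs.eta; congr (_ - _).
    by apply: eq_bigr => j _; rewrite mulrC.
  rewrite deriveB//=; last first.
    apply: diff_derivable; rewrite -fct_sumE; apply: differentiable_sum => j.
    exact: differentiableM.
  rewrite derive_cst sub0r derive_sumM//; congr (- _); apply: eq_bigr => j _.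
  rewrite derive_cst mulr0 addr0 (@derive_linear _ _ _ (fun y => pcoord y j)).
    by rewrite mkpointE mxE.
  by move=> h m y; rewrite !coordE.
rewrite /Lie_derivative deta /Defs.eta dzX (derive_decomp v dK).
under [X in _ + (_ - X)]eq_bigr do rewrite dqX.
set A := \sum_j _; set C := \sum_j _; set B := \sum_j _.
set D := \sum_j _; set F := \sum_j _.
(* Second derivatives of [K] cancel between [B] and [D], its [p]-derivatives between [C] and [B],
   its [q]-derivatives between [C] and [A]. Only the [z]-derivative in [A] survives. *)
have sumsE : C - B - A - D = - ('D_dz K x * F).
  rewrite /A /B /C /D /F mulr_sumr -!sumrB -sumrN.
  by apply: eq_bigr => j _; ring.
rewrite mulrBr -sumsE; ring.
Qed.

End contact_hamiltonian.

(** * The Hamiltonian extending a field on the Legendre submanifold *)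

Section legendre_extension.
Context {R : realType} {n l : nat} (I : {set 'I_n}).
Variables (U : set 'rV[R]_n) (S : 'rV[R]_n -> R).
Variable f : 'I_n -> 'rV[R]_n * 'rV[R]_l -> R.
Local Notation E := 'rV[R]_(n + n + 1).
Implicit Types (x v : E) (u : 'rV[R]_n) (r j : 'I_n) (k : nat).

(** A linear left inverse of [legendre_param]: composing with it extends functions of [u] to the
    ambient space. *)
Definition chart x : 'rV[R]_n :=
  \row_j (if j \in I then qcoord x j else pcoord x j).

(** Signed so that [defect] vanishes on the submanifold for every [r]. *)
Definition conjugate r x : R := if r \in I then - pcoord x r else qcoord x r.

Definition defect r x : R := conjugate r x + partial r S (chart x).

(** Defined on pairs of a point and a parameter, so that smoothness can be stated jointly in
    both. *)
Definition legendre_hamiltonian (y : E * 'rV[R]_l) : R :=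
  \sum_r f r (chart y.1, y.2) * defect r y.1.

Lemma chart_linear (h : R) v x : chart (h *: v + x) = h *: chart v + chart x.
Proof. by apply/rowP => j; rewrite !mxE; case: ifP; rewrite !coordE. Qed.

Lemma conjugate_linear r (h : R) v x :
  conjugate r (h *: v + x) = h *: conjugate r v + conjugate r x.
Proof.
by rewrite /conjugate; case: ifP; rewrite !coordE// opprD scalerN.
Qed.

Lemma differentiable_chart x : differentiable chart x.
Proof.
apply: differentiable_row => j; case: (j \in I); exact: differentiable_coord.
Qed.

Lemma differentiable_conjugate r x : differentiable (conjugate r) x.
Proof.
rewrite /conjugate; case: (r \in I); last exact: differentiable_coord.
apply: differentiableN; exact: differentiable_coord.
Qed.

Lemma chart_param u : chart (legendre_param I S u) = u.
Proof.
apply/rowP => j; rewrite !mxE /legendre_param !mkpointE !mxE.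
by case: (j \in I).
Qed.

Lemma defect_param r u : defect r (legendre_param I S u) = 0.
Proof.
rewrite /defect chart_param /conjugate /legendre_param !mkpointE !mxE.
by case: (r \in I); rewrite addNr.
Qed.

Hypothesis openU : open U.
Hypothesis smoothS : smooth_on U S.
Hypothesis smoothf : forall r, smooth_on (U `*` setT) (f r).
Local Notation W := (chart @^-1` U).

Lemma open_chart : open W.
Proof.
apply: open_comp => // x _.
exact: differentiable_continuous (differentiable_chart x).
Qed.

Lemma smooth_partial j : smooth_on U (partial j S).
Proof. by move=> k; exact: (smoothS k.+1).2. Qed.

Lemma smooth_defect r : smooth_on W (defect r).
Proof.
move=> k; apply: Ck_onD; first exact: open_chart.
  apply: Ck_on_linear; last exact: conjugate_linear.
  exact: differentiable_conjugate.
apply: (Ck_on_comp_affine (M := chart)) (smooth_partial r k) => //.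
- exact: differentiable_chart.
- exact: chart_linear.
Qed.

Lemma smooth_hamiltonian :
  smooth_on (W `*` [set: 'rV[R]_l]) legendre_hamiltonian.
Proof.
move=> k; have oW := open_setXT (V' := 'rV[R]_l) open_chart.
apply: Ck_on_sum => // r; apply: Ck_onM => //; last first.
  exact/Ck_on_fst/smooth_defect.
pose L (y : E * 'rV[R]_l) := (chart y.1, y.2).
apply: (@Ck_on_comp_affine _ _ _ _ _ (U `*` setT) _ (f r) L L) => //.
- move=> y; apply: differentiable_pair; last exact: differentiable_snd.
  apply: differentiable_comp; first exact: differentiable_fst.
  exact: differentiable_chart.
- by move=> h m y; rewrite /L /= chart_linear.
- exact: smoothf.
Qed.

Variable lambda : 'rV[R]_l.

Lemma legendre_hamiltonian_slice k :
  Ck_on k W (fun x => legendre_hamiltonian (x, lambda)).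
Proof.
apply: (@Ck_on_comp_affine _ _ _ _ _ (W `*` setT) _ legendre_hamiltonian
  (fun x => (x, lambda)) (fun v => (v, 0))) => //.
- by move=> h m y; congr (_, _); rewrite /= scaler0 add0r.
- exact: smooth_hamiltonian.
Qed.

(** Each defect vanishes at the point, so the Leibniz terms that differentiate [f] drop out. *)
Lemma derive_hamiltonian v u : U u ->
  'D_v (fun x => legendre_hamiltonian (x, lambda)) (legendre_param I S u) =
  \sum_r f r (u, lambda) *
    (conjugate r v + 'D_(delta_mx ord0 r) (fun w => 'D_(chart v) S w) u).
Proof.
move=> Uu; set x := legendre_param I S u.
have Wx : W x by rewrite /= /x chart_param.
have dg r : differentiable (fun x => f r (chart x, lambda)) x.
  apply: (@differentiable_comp _ _ _ _ (fun x => (chart x, lambda)) (f r)).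
    by apply: differentiable_pair => //; exact: differentiable_chart.
  apply: (smoothf r 1).1; split => //.
have dd r : differentiable (defect r) x by apply: (smooth_defect r 1).1.
rewrite derive_sumM//; apply: eq_bigr => r _.
rewrite /x defect_param mul0r addr0 chart_param; congr (_ * _).
have dS : differentiable (partial r S) (chart x).
  by apply: (smooth_partial r 1).1.
rewrite deriveD; first last.
- apply: diff_derivable; apply: (@differentiable_comp _ _ _ _ chart) => //.
  exact: differentiable_chart.
- exact/diff_derivable/differentiable_conjugate.
rewrite derive_linear; last exact: conjugate_linear.
congr (_ + _).
rewrite (@derive_comp_affine _ _ _ _ (partial r S) chart _ _ (chart v)).
  (* Symmetry moves [chart v] to the inner derivative; for a coordinate vector [v] it is a basis
     vector or zero, which yields the second partials occurring in [derive_param]. *)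
  rewrite chart_param; apply: derive_symmetric openU Uu _; exact: smoothS.
by move=> h; exact: chart_linear.
Qed.

Lemma smooth_param : smooth_on U (legendre_param I S).
Proof.
move=> k; have sp j : Ck_on k U (partial j S) by exact: smooth_partial.
have sc j : Ck_on k U (fun w : 'rV[R]_n => w ord0 j) by exact: Ck_on_coord.
apply: Ck_on_point => // [j|j|].
- under eq_fun do rewrite mkpointE mxE.
  by case: (j \in I) => //; exact: Ck_onN.
- under eq_fun do rewrite mkpointE mxE.
  by case: (j \in I).
- under eq_fun do rewrite mkpointE big_mkcond.
  apply: Ck_onD => //; apply: Ck_onN => //; apply: Ck_on_sum => // a.
  by case: (a \notin I); [exact: Ck_onM|exact: Ck_on_cst].
Qed.

Lemma derive_coord_delta m (u : 'rV[R]_m) (i j : 'I_m) :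
  'D_(delta_mx ord0 i) (fun w : 'rV[R]_m => w ord0 j) u = (i == j)%:R.
Proof.
by rewrite derive_linear => [|h v w]; rewrite !mxE// eq_sym.
Qed.

Lemma derive_param r u : U u ->
  'D_(delta_mx ord0 r) (legendre_param I S) u = mkpoint
    (\row_j if j \in I then (r == j)%:R else - partial r (partial j S) u)
    (\row_j if j \in I then partial r (partial j S) u else (r == j)%:R)
    (\sum_j if j \in I then (r == j)%:R * partial j S u
             else - (u ord0 j * partial r (partial j S) u)).
Proof.
move=> Uu; set e := delta_mx ord0 r.
have dX : derivable (legendre_param I S) u e.
  by apply: diff_derivable; apply: (smooth_param 1).1.
have dS j : differentiable (partial j S) u by apply: (smooth_partial j 1).1.
have dc j : differentiable (fun w : 'rV[R]_n => w ord0 j) u.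
  exact: differentiable_coord.
apply: point_ext => [j|j|].
- rewrite /qcoord derive_coord// -/(qcoord _ _) mkpointE mxE.
  under eq_fun do rewrite -/(qcoord _ _) mkpointE mxE.
  case: (j \in I); first exact: derive_coord_delta.
  by rewrite deriveN//; exact: diff_derivable.
- rewrite /pcoord derive_coord// -/(pcoord _ _) mkpointE mxE.
  under eq_fun do rewrite -/(pcoord _ _) mkpointE mxE.
  case: (j \in I) => //; exact: derive_coord_delta.
- rewrite /zcoord derive_coord// -/(zcoord _) mkpointE.
  (* Zero coefficients on [I] turn the sum over the complement of [I] into a sum over all
     indices. *)
  pose c j (w : 'rV[R]_n) := if j \in I then 0 else w ord0 j.
  have dcI j : differentiable (c j) u.
    by rewrite /c; case: (j \in I).
  have cE : (fun w => zcoord (legendre_param I S w)) =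
      (fun w => S w - \sum_j c j w * partial j S w).
    apply/funext => w; rewrite mkpointE big_mkcond; congr (_ - _).
    by apply: eq_bigr => j _; rewrite /c; case: (j \in I); rewrite ?mul0r.
  rewrite -[LHS]/('D_e (fun w => zcoord (legendre_param I S w)) u) cE.
  rewrite deriveB; first last.
  + apply: diff_derivable; rewrite -fct_sumE; apply: differentiable_sum => j.
    exact: differentiableM.
  + by apply: diff_derivable; apply: (smoothS 1).1.
  (* Spread over all [j], this derivative cancels index by index, for [j] outside [I], the terms
     where the coordinate [u_j] is differentiated. *)
  have -> : 'D_e S u = \sum_j (r == j)%:R * partial j S u.
    rewrite (bigD1 r)//= eqxx mul1r big1 ?addr0// => j.
    by rewrite eq_sym => /negbTE ->; rewrite mul0r.
  rewrite derive_sumM// -sumrB; apply: eq_bigr => j _.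
  rewrite /c; case: (j \in I).
    by rewrite mul0r add0r derive_cst mulr0 subr0.
  rewrite derive_coord_delta [partial j S u * _]mulrC.
  by rewrite opprD addrCA subrr addr0.
Qed.

Lemma chart_dp j : chart (dp j) = if j \in I then 0 else delta_mx ord0 j.
Proof.
apply/rowP => i; rewrite !mxE !mkpointE !mxE /=.
have [->|ij] := eqVneq i j; first by case: (j \in I); rewrite !mxE ?eqxx.
by case: (j \in I); rewrite !mxE ?(negbTE ij) if_same.
Qed.

Lemma chart_dq j : chart (dq j) = if j \in I then delta_mx ord0 j else 0.
Proof.
apply/rowP => i; rewrite !mxE !mkpointE !mxE /=.
have [->|ij] := eqVneq i j; first by case: (j \in I); rewrite !mxE ?eqxx.
by case: (j \in I); rewrite !mxE ?(negbTE ij) if_same.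
Qed.

Lemma chart_dz : chart dz = 0.
Proof.
by apply/rowP => i; rewrite !mxE !mkpointE !mxE; case: (i \in I).
Qed.

Lemma conjugate_dp r j : conjugate r (dp j) = - ((j \in I) && (r == j))%:R.
Proof.
rewrite /conjugate !mkpointE !mxE /=.
have [->|_] := eqVneq r j; rewrite ?andbT ?andbF.
  by case: (j \in I); rewrite ?oppr0.
by case: (r \in I); rewrite ?oppr0.
Qed.

Lemma conjugate_dq r j : conjugate r (dq j) = ((j \notin I) && (r == j))%:R.
Proof.
rewrite /conjugate !mkpointE !mxE /=.
have [->|_] := eqVneq r j; rewrite ?andbT ?andbF.
  by case: (j \in I); rewrite ?oppr0.
by case: (r \in I); rewrite ?oppr0.
Qed.

Lemma conjugate_dz r : conjugate r dz = 0.
Proof. by rewrite /conjugate !mkpointE !mxE oppr0 if_same. Qed.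

Lemma hamiltonian_field_param u : U u ->
  hamiltonian_field (fun x => legendre_hamiltonian (x, lambda))
    (legendre_param I S u) =
  legendre_field I S (fun r => f r (u, lambda)) u.
Proof.
move=> Uu; set x := legendre_param I S u.
pose D r j := partial r (partial j S) u.
pose F r := f r (u, lambda).
(* This covers directions that [chart] sends to zero: only the conjugate part of the derivative of
   the Hamiltonian remains. *)
have D0 e : 'D_e (fun w => 'D_0 S w) u = 0.
  by under eq_fun do rewrite derive0; rewrite derive_cst.
have sumF j : \sum_r F r * (r == j)%:R = F j.
  rewrite (bigD1 j)//= big1 ?eqxx ?mulr1 ?addr0// => r rj.
  by rewrite (negbTE rj) mulr0.
have hp j : 'D_(dp j) (fun x => legendre_hamiltonian (x, lambda)) x =
    if j \in I then - F j else \sum_r F r * D r j.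
  rewrite derive_hamiltonian// chart_dp.
  under eq_bigr do rewrite conjugate_dp.
  case: (j \in I) => /=; last by under eq_bigr do rewrite oppr0 add0r.
  by under eq_bigr do rewrite D0 addr0 mulrN; rewrite sumrN sumF.
have hq j : 'D_(dq j) (fun x => legendre_hamiltonian (x, lambda)) x =
    if j \in I then \sum_r F r * D r j else F j.
  rewrite derive_hamiltonian// chart_dq.
  under eq_bigr do rewrite conjugate_dq.
  case: (j \in I) => /=; first by under eq_bigr do rewrite add0r.
  by under eq_bigr do rewrite D0 addr0; rewrite sumF.
have hz : 'D_dz (fun x => legendre_hamiltonian (x, lambda)) x = 0.
  rewrite derive_hamiltonian// chart_dz big1// => r _.
  by rewrite conjugate_dz D0 addr0 mulr0.
have h0 : legendre_hamiltonian (x, lambda) = 0.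
  by apply: big1 => r _; rewrite defect_param mulr0.
rewrite /legendre_field /hamiltonian_field hz h0.
apply: point_ext => [j|j|]; rewrite mkpointE ?mxE coordE.
- rewrite hp; under [RHS]eq_bigr do
    rewrite qcoordZ /partial derive_param// mkpointE mxE.
  case: (j \in I); first by rewrite opprK sumF.
  by rewrite -sumrN; apply: eq_bigr => r _; rewrite mulrN.
- rewrite hq mulr0 addr0.
  under [RHS]eq_bigr do rewrite pcoordZ /partial derive_param// mkpointE mxE.
  by case: (j \in I).
(* With [K = 0] the [z]-component is minus the sum of the [p_j] times the [p_j]-derivatives of [K].
   Here [p_j] is [partial j S u] on [I] and [u_j] off [I], so after exchanging sums the two sides
   agree for each [j]. *)
- under [RHS]eq_bigr do
    rewrite zcoordZ /partial derive_param// mkpointE mulr_sumr.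
  rewrite exchange_big sub0r -sumrN; apply: eq_bigr => j _ /=.
  rewrite hp /x mkpointE mxE; case: (j \in I).
    rewrite mulrN opprK -(sumF j) mulr_sumr; apply: eq_bigr => r _.
    by rewrite mulrC mulrA.
  rewrite mulr_sumr -sumrN; apply: eq_bigr => r _.
  by rewrite mulrN mulrCA.
Qed.

End legendre_extension.

(** * The extension theorem, with smoothness joint in point and parameter *)

Unset Implicit Arguments.
Set Strict Implicit.

Theorem theorem5p2 (R : realType) (n l : nat) (I : {set 'I_n})
    (U : set 'rV[R]_n) (S : 'rV[R]_n -> R)
    (f : 'I_n -> 'rV[R]_n * 'rV[R]_l -> R)
    (openU : open U) (smoothS : smooth_on U S)
    (smoothf : forall r, smooth_on (U `*` setT) (f r)) :
  exists (W : set 'rV[R]_(n + n + 1))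
         (X : 'rV[R]_l -> 'rV[R]_(n + n + 1) -> 'rV[R]_(n + n + 1)),
    [/\ open W,
        legendre_param I S @` U `<=` W,
        smooth_on (W `*` setT) (fun y => X y.2 y.1),
        forall lambda, contact_field_on W (X lambda) &
        forall lambda u, U u ->
          X lambda (legendre_param I S u) =
          legendre_field I S (fun r => f r (u, lambda)) u].
Proof.
have oW := open_chart (I := I) openU.
exists (chart I @^-1` U), (fun lambda => hamiltonian_field
  (fun x => legendre_hamiltonian I S f (x, lambda))); split => //.
- by move=> _ [u Uu <-] /=; rewrite chart_param.
- have sK := smooth_hamiltonian I openU smoothS smoothf.
  have oZ := open_setXT (V' := 'rV[R]_l) oW.
  (* A derivative of a slice at fixed [lambda] is the derivative of the joint Hamiltonian along
     [(v, 0)], hence jointly smooth. *)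
  have DE v :
      (fun y => 'D_v (fun x => legendre_hamiltonian I S f (x, y.2)) y.1) =
      (fun y => 'D_(v, 0) (legendre_hamiltonian I S f) y).
    apply/funext => -[x lambda] /=.
    apply: (derive_comp_affine _ (L := fun x => (x, lambda))) => h.
    by congr (_, _); rewrite /= scaler0 add0r.
  have sDK v k : Ck_on k (chart I @^-1` U `*` setT)
      (fun y => 'D_v (fun x => legendre_hamiltonian I S f (x, y.2)) y.1).
    by rewrite DE; exact: (sK k.+1).2.
  have sp k j : Ck_on k (chart I @^-1` U `*` [set: 'rV[R]_l])
      (fun y => pcoord y.1 j).
    exact: Ck_on_fst (Ck_on_coord _ _ _).
  move=> k; apply: Ck_on_point => // [j|j|].
  + under eq_fun do rewrite mkpointE mxE.
    exact: Ck_onN.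
  + under eq_fun do rewrite mkpointE mxE.
    by apply: Ck_onD => //; exact: Ck_onM.
  + under eq_fun do rewrite mkpointE.
    apply: Ck_onD => //.
    by apply: Ck_onN => //; apply: Ck_on_sum => // j; exact: Ck_onM.
- move=> lambda; apply: contact_hamiltonian_field => // k.
  exact: legendre_hamiltonian_slice.
- by move=> lambda u; exact: hamiltonian_field_param.
Qed.
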